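(* Given a configuration of four oriented circles in the plane with non-zero oriented curvatures $(b_1,b_2,b_3,b_4)$ and centers $\{(x_i,y_i): 1\le i\le 4\}$, let $\mathbf{M}$ be the $4\times 3$ matrix $$\mathbf{M} := \begin{bmatrix} b_1 & b_1x_1 & b_1y_1\\ b_2 & b_2x_2 & b_2y_2\\ b_3 & b_3x_3 & b_3y_3\\ b_4 & b_4x_4 & b_4y_4\end{bmatrix}.$$ Then this configuration is an oriented Descartes configuration if and only if $$\mathbf{M}^T \mathbf{Q}_2 \mathbf{M} = \begin{bmatrix} 0&0&0\\0&2&0\\0&0&2\end{bmatrix}.$$ Moreover, for an oriented Descartes configuration in which one or two of the curvatures $b_i$ are zero (the corresponding circles being oriented straight lines, with infinite centers), the same matrix identity remains true when the row of $\mathbf{M}$ corresponding to a straight line with oriented unit normal $(h_1,h_2)$ is defined to be $(0,h_1,h_2)$.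
   Context: $\mathbf{Q}_2 := I_4 - \frac12 \mathbf{1}_4\mathbf{1}_4^T$, where $\mathbf{1}_4$ is the column vector of four $1$'s. A Descartes configuration is a set of four mutually tangent circles in the plane in which no three circles have a common tangent (i.e. the pairs of tangent circles have distinct points of tangency). Straight lines are allowed as degenerate circles; two parallel lines are regarded as tangent at infinity. An oriented circle is a circle with an assigned direction of unit normal vector, pointing inward or outward. If the circle has radius $r>0$, its oriented curvature is $1/r$ for an inward pointing normal and $-1/r$ for an outward pointing normal. The interior of an oriented circle is its usual interior for an inward pointing normal, and its usual exterior for an outward pointing normal. A straight line is oriented by a unit normal vector $h=(h_1,h_2)$; it has oriented curvature $0$ and its interior is the open half-plane into which $h$ points. An oriented Descartes configuration is a Descartes configuration of oriented circles such that either the interiors of all four oriented circles are disjoint, or the interiors are disjoint when all orientations are reversed. *)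

(* Defs.v *)
From mathcomp Require Import all_boot all_order all_algebra.
From mathcomp Require Import classical_sets reals.

Set Implicit Arguments.
Unset Strict Implicit.
Unset Printing Implicit Defensive.

Import Order.TTheory GRing.Theory Num.Theory.
Local Open Scope ring_scope.
Local Open Scope classical_set_scope.

Section Circles.
Variable R : realType.

Notation plane := (R * R)%type.

Definition dot (u v : plane) : R := u.1 * v.1 + u.2 * v.2.

Definition sqdist (u v : plane) : R := (u.1 - v.1) ^+ 2 + (u.2 - v.2) ^+ 2.

(* [OCircle z r inward _] has centre z, radius r, and its unit normal points
   inward iff [inward] holds; [OLine h p _] is the line {w | h . w = p},
   oriented by the unit normal h. *)
Inductive ocircle : Type :=
| OCircle (z : plane) (r : R) (inward : bool) of 0 < r
| OLine (h : plane) (p : R) of dot h h = 1.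

Definition curvature (C : ocircle) : R :=
  match C with
  | OCircle _ r inward _ => if inward then r^-1 else - r^-1
  | OLine _ _ _ => 0
  end.

Definition interior (C : ocircle) : set plane :=
  match C with
  | OCircle z r inward _ =>
      if inward then [set w | sqdist w z < r ^+ 2]
      else [set w | r ^+ 2 < sqdist w z]
  | OLine h p _ => [set w | p < dot h w]
  end.

Lemma dot_opp (h : plane) : dot h h = 1 -> dot (- h) (- h) = 1.
Proof. by rewrite /dot /= !mulrNN. Qed.

Definition reverse (C : ocircle) : ocircle :=
  match C with
  | OCircle z r inward r_gt0 => OCircle z (~~ inward) r_gt0
  | OLine h p h1 => OLine (- p) (dot_opp h1)
  end.

(* The points of the underlying unoriented circle in the extended plane
   [option plane], where [None] is the point at infinity, which lies on every
   straight line. *)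
Definition points (C : ocircle) : set (option plane) :=
  match C with
  | OCircle z r _ _ => [set Some w | w in [set w | sqdist w z = r ^+ 2]]
  | OLine h p _ => None |` [set Some w | w in [set w | dot h w = p]]
  end.

(* Tangency: exactly one common point in the extended plane.  Distinct parallel
   lines are thus tangent at [None], whereas crossing lines have two common
   points and are not tangent. *)
Definition tangent_at (C D : ocircle) (P : option plane) : Prop :=
  points C `&` points D = [set P].

Definition descartes (c : 'I_4 -> ocircle) : Prop :=
  (forall i j, i != j -> exists P, tangent_at (c i) (c j) P) /\
  (forall i j k l P, i != j -> k != l ->
     tangent_at (c i) (c j) P -> tangent_at (c k) (c l) P ->
     [set i; j]%SET = [set k; l]%SET).

Definition disjoint_interiors (c : 'I_4 -> ocircle) : Prop :=
  forall i j, i != j -> interior (c i) `&` interior (c j) = set0.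

Definition oriented_descartes (c : 'I_4 -> ocircle) : Prop :=
  descartes c /\
  (disjoint_interiors c \/ disjoint_interiors (fun i => reverse (c i))).

Definition curvature_center_row (C : ocircle) : 'rV[R]_3 :=
  match C with
  | OCircle z _ _ _ =>
      let b := curvature C in \row_j [:: b; b * z.1; b * z.2]`_j
  | OLine h _ _ => \row_j [:: 0; h.1; h.2]`_j
  end.

Definition curvature_center_mx (c : 'I_4 -> ocircle) : 'M[R]_(4, 3) :=
  \matrix_(i < 4) curvature_center_row (c i).

Definition ones4 : 'cV[R]_4 := const_mx 1.

Definition Q2 : 'M[R]_4 := 1%:M - 2^-1 *: (ones4 *m ones4^T).

Definition diag022 : 'M[R]_3 := diag_mx (\row_j [:: 0; 2; 2]`_j).

End Circles.

Arguments Q2 {R}.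
Arguments diag022 {R}.

(* Main.v *)
(* A circle a - 2 u.w + b|w|^2 = 0 normalized by |u|^2 - a b = 1 is a unit
   vector (a, b, u) for the Lorentzian form u.u' - (a b' + b a') / 2, and its
   interior is where the left-hand side is negative.  At a common point of two
   circles the form is the inner product of the unit normals, so tangent circles
   with disjoint interiors have product -1, and an oriented Descartes
   configuration has Gram matrix 2 Q2.  Inverting W K W^T = 2 Q2, where W is M
   augmented by the column of the a's, gives W^T Q2 W = 2 K^-1, which contains
   the identity for M.
   Conversely, since the first column of M is a nonzero null vector of Q2, M can
   be completed to a solution W, and the diagonal of W K W^T = 2 Q2 forces the
   new column to consist of the a's.  Then sums of two rows are null vectors
   representing the tangency points, and as the products of these null vectors
   are negative, all b_i + b_j have the same sign, which orients the
   configuration. *)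
Require Import Defs.
From mathcomp Require Import all_boot all_order all_algebra.
From mathcomp Require Import classical_sets reals.
From mathcomp Require Import ring lra.
Import Order.TTheory GRing.Theory Num.Theory.
Local Open Scope ring_scope.

Section InversiveCoordinates.
Set Implicit Arguments.
Unset Strict Implicit.
Variable R : realType.
Implicit Types (C D E : ocircle R) (w : R * R) (c : 'I_4 -> ocircle R).

(** * Inversive coordinates of oriented circles and their Lorentzian form *)

(** The coefficient a; it is the oriented curvature of the image of [C] under inversion in the unit
    circle. *)
Definition cocurvature C : R :=
  match C with
  | OCircle z r _ _ => curvature C * (dot z z - r ^+ 2)
  | OLine _ p _ => 2 * p
  end.

Definition moment C : R * R :=
  match C with
  | OCircle z _ _ _ => (curvature C * z.1, curvature C * z.2)
  | OLine h _ _ => h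
  end.

Definition pairing C D : R :=
  dot (moment C) (moment D)
  - (cocurvature C * curvature D + curvature C * cocurvature D) / 2.

Definition side C w : R :=
  cocurvature C - 2 * dot (moment C) w + curvature C * dot w w.

Lemma pairingC C D : pairing C D = pairing D C.
Proof. by rewrite /pairing /dot; ring. Qed.

Lemma pairingCC C : pairing C C = 1.
Proof.
case: C => [z r inward r0|h p h1]; rewrite /pairing /= /dot /=.
  by case: inward => /=; field; rewrite gt_eqF.
by move: h1; rewrite /dot => h1; rewrite h1; ring.
Qed.

Lemma side_circle (z : R * R) (r : R) inward (r0 : 0 < r) w :
  let C := OCircle z inward r0 in
  side C w = curvature C * (sqdist w z - r ^+ 2).
Proof. by rewrite /side /sqdist /= /dot /=; ring. Qed.

Lemma interiorE C w : interior C w <-> side C w < 0.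
Proof.
case: C => [z r inward r0|h p h1]; last first.
  by rewrite /side /= /dot /=; split=> ?; lra.
rewrite side_circle; case: inward => /=.
  by rewrite pmulr_rlt0 ?invr_gt0// subr_lt0.
by rewrite nmulr_rlt0 ?oppr_lt0 ?invr_gt0// subr_gt0.
Qed.

Lemma curvature_circle_neq0 (z : R * R) (r : R) inward (r0 : 0 < r) :
  curvature (OCircle z inward r0) != 0.
Proof. by case: inward; rewrite /= ?oppr_eq0 invr_eq0 gt_eqF. Qed.

Lemma pointsE C w : points C (Some w) <-> side C w = 0.
Proof.
case: C => [z r inward r0|h p h1]; last first.
  rewrite /side /= /dot /=; split; last first.
    by move=> ?; right; exists w => //; rewrite /dot /=; lra.
  by move=> [//|[v /= + [<-]]]; rewrite /dot => ?; lra.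
rewrite side_circle /=; split.
  by move=> [v /= vz [<-]]; rewrite vz subrr mulr0.
move=> /eqP; rewrite mulf_eq0 (negbTE (curvature_circle_neq0 z inward r0)) /=.
by rewrite subr_eq0 => /eqP wz; exists w.
Qed.

Lemma side_reverse C w : side (reverse C) w = - side C w.
Proof. by case: C => [z r [] r0|h p h1]; rewrite /side /= /dot /=; ring. Qed.

Lemma pairing_reverse C D : pairing (reverse C) (reverse D) = pairing C D.
Proof.
by case: C => [z r [] r0|h p h1]; case: D => [z' r' [] r0'|h' p' h1'];
  rewrite /pairing /= /dot /=; ring.
Qed.

(** * Tangent circles with disjoint interiors have product -1 *)

(** Minus half the gradient of [side C] at [w]: on the circle, the unit normal pointing into the
    interior. *)
Definition normal C w : R * R :=
  ((moment C).1 - curvature C * w.1, (moment C).2 - curvature C * w.2).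

Lemma dot_normal C D w : dot (normal C w) (normal D w) =
  pairing C D + (curvature C * side D w + curvature D * side C w) / 2.
Proof. by rewrite /pairing /side /normal /dot /=; field. Qed.

Lemma side_shift C w t : side C (w + t) =
  side C w - 2 * dot (normal C w) t + curvature C * dot t t.
Proof. by rewrite /side /normal /= /dot /=; ring. Qed.

Lemma dot_unit_gtN1 (m n : R * R) :
  dot m m = 1 -> dot n n = 1 -> dot m n <> -1 -> 0 < 1 + dot m n.
Proof.
rewrite /dot => m1 n1 mn; rewrite lt_def; apply/andP; split.
  by apply/eqP => e; apply: mn; lra.
have := sqr_ge0 (m.1 + n.1); have := sqr_ge0 (m.2 + n.2); rewrite !expr2; nra.
Qed.

Lemma disjoint_pairing_at C D w : side C w = 0 -> side D w = 0 ->
  (interior C `&` interior D = set0)%classic -> pairing C D = -1.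
Proof.
move=> Cw Dw CD0; apply/eqP; apply: contraPT CD0 => /eqP CD.
have nCD : dot (normal C w) (normal D w) = pairing C D.
  by rewrite dot_normal Cw Dw; ring.
have n1 E : side E w = 0 -> dot (normal E w) (normal E w) = 1.
  by move=> Ew; rewrite dot_normal pairingCC Ew; ring.
have n1C := n1 _ Cw; have n1D := n1 _ Dw.
have s0 := dot_unit_gtN1 n1C n1D; rewrite nCD in s0; have {s0} := s0 CD.
set s := pairing C D in nCD CD * => s0.
(* Both circles are entered by a short step in the direction of the sum of the
   unit normals. *)
pose e := (1 + `|curvature C| + `|curvature D|)^-1.
have den0 : 0 < 1 + `|curvature C| + `|curvature D|.
  by rewrite -addrA ltr_pwDl ?addr_ge0.
have e0 : 0 < e by rewrite invr_gt0.
have be E : `|curvature E| < 1 + `|curvature C| + `|curvature D| ->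
    e * curvature E < 1.
  move=> bE; rewrite mulrC ltr_pdivrMr// mul1r.
  exact: le_lt_trans (ler_norm _) bE.
pose t := (e * ((normal C w).1 + (normal D w).1),
           e * ((normal C w).2 + (normal D w).2)).
have tt : dot t t = 2 * e ^+ 2 * (1 + s).
  transitivity (e ^+ 2 * (dot (normal C w) (normal C w) +
    dot (normal D w) (normal D w) + 2 * dot (normal C w) (normal D w))).
    by rewrite /t /dot /=; ring.
  by rewrite nCD n1C n1D; ring.
have tC : dot (normal C w) t = e * (1 + s).
  by rewrite -nCD -[in RHS]n1C /t /dot /=; ring.
have tD : dot (normal D w) t = e * (1 + s).
  by rewrite -nCD -[in RHS]n1D /t /dot /=; ring.
(* Here [side E (w + t)] is -2 e (1 + s) (1 - e b) with b the curvature of [E]: the first-order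
   decrease outweighs the quadratic term once e b < 1. *)
have inE E : side E w = 0 -> dot (normal E w) t = e * (1 + s) ->
    e * curvature E < 1 -> interior E (w + t).
  move=> Ew tE bE; apply/interiorE; rewrite side_shift Ew tE tt.
  have es := mulr_gt0 e0 s0.
  rewrite [X in X < _](_ : _ = - (2 * (e * (1 + s)) * (1 - e * curvature E))).
    by rewrite oppr_lt0 !mulr_gt0// subr_gt0.
  by ring.
move=> /seteqP[/(_ (w + t)) + _]; apply; split; apply: inE => //; apply: be.
  have := normr_ge0 (curvature D); lra.
have := normr_ge0 (curvature C); lra.
Qed.

(** For lines tangent at infinity, which need not have a finite common point. Unless the normals are
    opposite, a long enough step along their sum enters both half-planes. *)
Lemma disjoint_lines h p (h1 : dot h h = 1) h' p' (h1' : dot h' h' = 1 :> R) :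
  (interior (OLine p h1) `&` interior (OLine p' h1') = set0)%classic ->
  dot h h' = -1.
Proof.
move=> CD0; apply/eqP; apply: contraPT CD0 => /eqP.
move/(dot_unit_gtN1 h1 h1') => s0.
pose e := (1 + `|p| + `|p'|) / (1 + dot h h').
have es : e * (1 + dot h h') = 1 + `|p| + `|p'| by rewrite divfK// gt_eqF.
pose t := (e * (h.1 + h'.1), e * (h.2 + h'.2)).
have ht : dot h t = 1 + `|p| + `|p'|.
  by rewrite -es -h1 /t /dot /=; ring.
have ht' : dot h' t = 1 + `|p| + `|p'|.
  by rewrite -es -h1' /t /dot /=; ring.
have := ler_norm p; have := ler_norm p'; have := normr_ge0 p.
have := normr_ge0 p'.
by move=> ? ? ? ? /seteqP[/(_ t) + _]; apply; split; rewrite /= ?ht ?ht'; lra.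
Qed.

Lemma tangent_disjoint_pairing C D P : tangent_at C D P ->
  (interior C `&` interior D = set0)%classic -> pairing C D = -1.
Proof.
move=> CDP CD0; case: P CDP => [w|] /seteqP[_ /(_ _ erefl)] [].
  by move=> /pointsE Cw /pointsE Dw; apply: disjoint_pairing_at Cw Dw CD0.
case: C CD0 => [? ? ? ?|h p h1] CD0; first by move=> [].
case: D CD0 => [? ? ? ?|h' p' h1'] CD0; first by move=> _ [].
by move=> _ _; rewrite /pairing /= (disjoint_lines CD0); ring.
Qed.

Lemma oriented_descartes_pairing c : oriented_descartes c ->
  forall i j, i != j -> pairing (c i) (c j) = -1.
Proof.
move=> [[tg _] dj] i j ij; have [P cP] := tg _ _ ij.
case: dj => /(_ i j ij); first exact: tangent_disjoint_pairing cP.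
rewrite -pairing_reverse; apply: tangent_disjoint_pairing.
have ptsr C : points (reverse C) = points C.
  apply/seteqP; split => -[w|]; try by case: C => // *; left.
    by move=> /pointsE /eqP; rewrite side_reverse oppr_eq0 => /eqP /pointsE.
  by move=> /pointsE Cw; apply/pointsE; rewrite side_reverse Cw oppr0.
by rewrite /tangent_at !ptsr; exact: cP.
Qed.

(** * From products -1 to an oriented Descartes configuration *)

Lemma dot_add (m n : R * R) :
  dot (m + n) (m + n) = dot m m + dot n n + 2 * dot m n.
Proof. by rewrite /dot /=; ring. Qed.

Lemma dot_ge0 (m : R * R) : 0 <= dot m m.
Proof. by rewrite /dot -!expr2 addr_ge0 ?sqr_ge0. Qed.

Lemma dot_eq0 (m : R * R) : dot m m = 0 -> m = 0.
Proof.
case: m => x y; rewrite /dot /= -!expr2 => /eqP.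
by rewrite paddr_eq0 ?sqr_ge0// !sqrf_eq0 => /andP[/eqP-> /eqP->].
Qed.

(* If [pairing C D = -1], the sum of the coordinates of [C] and [D] is a null
   vector, so it represents a point circle: the point of tangency. *)
Lemma dot_normalD C D w : pairing C D = -1 ->
  dot (normal C w + normal D w) (normal C w + normal D w) =
  (curvature C + curvature D) * (side C w + side D w).
Proof. by move=> CD; rewrite dot_add !dot_normal !pairingCC CD; field. Qed.

(** The centre u / b of that point circle, meaningful when the curvatures do not cancel. *)
Definition contact C D : R * R :=
  (((moment C).1 + (moment D).1) / (curvature C + curvature D),
   ((moment C).2 + (moment D).2) / (curvature C + curvature D)).

Lemma contact_normal C D w : curvature C + curvature D != 0 ->
  normal C w + normal D w = 0 -> w = contact C D.
Proof.
move=> CD e; have := congr1 fst e; have := congr1 snd e.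
rewrite /normal /= => e2 e1; apply: injective_projections; rewrite /contact /=.
  by rewrite -[LHS](mulfK CD); congr (_ / _); lra.
by rewrite -[LHS](mulfK CD); congr (_ / _); lra.
Qed.

(** The form evaluated on a null vector (a, b, u) and on [E] is [side E (u / b)] up to the factor -b
    / 2, because |u|^2 = a b. *)
Lemma side_contact C D E : curvature C + curvature D != 0 ->
  pairing C D = -1 ->
  (curvature C + curvature D) * side E (contact C D) =
  - 2 * (pairing E C + pairing E D).
Proof.
move=> b0 CD; have := dot_normalD 0 CD.
set U := ((moment C).1 + (moment D).1, (moment C).2 + (moment D).2).
rewrite /side (_ : normal C 0 + normal D 0 = U); last first.
  by rewrite /normal /U /= !mulr0 !subr0.
have -> : dot (moment C) 0 = 0 by rewrite /dot /=; ring.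
have -> : dot (moment D) 0 = 0 by rewrite /dot /=; ring.
have -> : dot 0 0 = 0 :> R by rewrite /dot /=; ring.
move=> UU.
have -> : dot (contact C D) (contact C D) =
  dot U U / (curvature C + curvature D) ^+ 2 by rewrite /dot /=; field.
by rewrite UU /pairing /contact /dot /=; field.
Qed.

Lemma side_contact0 C D : curvature C + curvature D != 0 ->
  pairing C D = -1 -> side C (contact C D) = 0 /\ side D (contact C D) = 0.
Proof.
move=> b0 CD; split; apply: (mulfI b0); rewrite side_contact// mulr0.
  by rewrite pairingCC CD; ring.
by rewrite pairingCC pairingC CD; ring.
Qed.

(** At a common point the sum of the two normals has length 0 by [dot_normalD], and its vanishing
    determines the point. *)
Lemma tangent_at_contact C D : curvature C + curvature D != 0 ->
  pairing C D = -1 -> tangent_at C D (Some (contact C D)).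
Proof.
move=> b0 CD; apply/seteqP; split=> [[w|]|_ ->]; last first.
- by have [Ck Dk] := side_contact0 b0 CD; split; apply/pointsE.
- case: C b0 CD => [z r i r0|h p h1] b0 CD; first by move=> [[]].
  by case: D b0 CD => [z r i r0|h' p' h1'] b0 CD;
    [move=> [_ []]|rewrite /= addr0 eqxx in b0].
move=> [/pointsE Cw /pointsE Dw]; congr Some.
apply: (contact_normal b0); apply: dot_eq0.
by rewrite dot_normalD// Cw Dw addr0 mulr0.
Qed.

Lemma third_index (i j : 'I_4) : exists k, (k != i) && (k != j).
Proof.
have: (0 < #|~: [set i; j]%SET|)%N.
  by rewrite cardsCs finset.setCK card_ord cards2; case: (_ != _).
by case/card_gt0P => k; rewrite !inE negb_or; exists k.
Qed.

Lemma pairing_oriented_descartes c : (forall i, curvature (c i) != 0) ->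
  (forall i j, i != j -> pairing (c i) (c j) = -1) -> oriented_descartes c.
Proof.
move=> c0 cp; pose B i j := curvature (c i) + curvature (c j).
(* If [B i j] vanished, the coordinates of [c j] would be those of [c i] negated, so their products
   with a third circle would cancel instead of adding up to -2. *)
have Bneq0 i j : i != j -> B i j != 0.
  move=> ij; have [k /andP[ki kj]] := third_index i j.
  apply/eqP => Bij.
  have := dot_normalD 0 (cp _ _ ij); rewrite -/(B i j) Bij mul0r => /dot_eq0 e.
  have := congr1 fst e; have := congr1 snd e.
  rewrite /normal /= !mulr0 !subr0 => e2 e1.
  have aa : curvature (c i) * (cocurvature (c i) + cocurvature (c j)) = 0.
    have := pairingCC (c i); have := pairingCC (c j).
    rewrite /pairing /dot.
    rewrite (_ : (moment (c j)).1 = - (moment (c i)).1); last by lra.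
    rewrite (_ : (moment (c j)).2 = - (moment (c i)).2); last by lra.
    rewrite (_ : curvature (c j) = - curvature (c i)); last first.
      by move: Bij; rewrite /B; lra.
    by lra.
  move/eqP: aa; rewrite mulf_eq0 (negbTE (c0 i)) /= => /eqP aa.
  have : pairing (c k) (c i) + pairing (c k) (c j) = 0.
    transitivity (dot (moment (c k)) (moment (c i) + moment (c j)) -
      (cocurvature (c k) * B i j +
       curvature (c k) * (cocurvature (c i) + cocurvature (c j))) / 2).
      by rewrite /pairing /dot /B /=; ring.
    by rewrite Bij aa /dot /= e1 e2; ring.
  by rewrite !cp//; lra.
(* In particular no third circle passes through a contact point. *)
have side4 i j k : i != j -> k != i -> k != j ->
    B i j * side (c k) (contact (c i) (c j)) = 4.
  by move=> ij ki kj; rewrite side_contact ?Bneq0 ?cp//; ring.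
(* At the contact point of [c i] and [c j], [side (c k)] times [B i j] is 4, and times [B i k] it is
   a squared length; so the two sums agree in sign. *)
have Bshare i j k : i != j -> i != k -> 0 < B i j * B i k.
  move=> ij ik; rewrite lt_def mulf_neq0 ?Bneq0//=.
  have [<-|jk] := eqVneq j k; first by rewrite -expr2 sqr_ge0.
  have [Ci _] := side_contact0 (Bneq0 _ _ ij) (cp _ _ ij).
  have s4 : B i j * side (c k) (contact (c i) (c j)) = 4.
    by rewrite side4// eq_sym.
  have := dot_ge0 (normal (c i) (contact (c i) (c j)) +
                   normal (c k) (contact (c i) (c j))).
  rewrite dot_normalD ?cp// Ci add0r -/(B i k).
  set s := side _ _ in s4 * => Bs.
  have s2 : 0 < s ^+ 2.
    rewrite exprn_even_gt0//=; apply/eqP => s0.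
    by move: s4; rewrite s0; lra.
  rewrite -(pmulr_rge0 _ s2).
  have -> : s ^+ 2 * (B i j * B i k) = (B i j * s) * (B i k * s) by ring.
  by rewrite s4 mulr_ge0.
have Btrans x y z : 0 < x * y -> 0 < y * z -> 0 < x * z :> R.
  move=> xy yz; have y0 : 0 < y ^+ 2.
    rewrite exprn_even_gt0//=; apply/eqP => y0.
    by rewrite y0 mulr0 ltxx in xy.
  rewrite -(pmulr_rgt0 _ y0).
  have -> : y ^+ 2 * (x * z) = x * y * (y * z) by ring.
  exact: mulr_gt0.
have Bsign i j k l : i != j -> k != l -> 0 < B i j * B k l.
  move=> ij; have [<-|ik] := eqVneq i k; first exact: Bshare.
  move=> kl.
  apply: (Btrans _ (B i k)); first exact: Bshare.
  by rewrite [B i k]addrC; apply: Bshare; rewrite // eq_sym.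
split; last first.
  (* In two overlapping interiors both values of [side] are negative, yet [B i j] times their sum is
     a squared length. Positive sums thus give disjoint interiors, and negative ones do so after
     reversal. *)
  have [i0 [i1 i01]] : exists i j : 'I_4, i != j by exists ord0, ord_max.
  have := Bsign _ _ _ _ i01 i01.
  have [B0|B0|->] := ltgtP (B i0 i1) 0; last by rewrite mulr0 ltxx.
    right=> i j ij; apply/seteqP; split=> // w [/interiorE + /interiorE].
    have := dot_ge0 (normal (c i) w + normal (c j) w).
    rewrite !side_reverse dot_normalD ?cp// nmulr_rge0.
      by move=> *; lra.
    by have := Bsign _ _ _ _ i01 ij; rewrite nmulr_rgt0.
  left=> i j ij; apply/seteqP; split=> // w [/interiorE + /interiorE].
  have := dot_ge0 (normal (c i) w + normal (c j) w).
  rewrite dot_normalD ?cp// pmulr_rge0.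
    by move=> *; lra.
  by have := Bsign _ _ _ _ i01 ij; rewrite pmulr_rgt0.
split=> [i j ij|i j k l P ij kl].
  exists (Some (contact (c i) (c j))).
  by apply: tangent_at_contact; rewrite ?Bneq0 ?cp.
rewrite /tangent_at (tangent_at_contact (Bneq0 _ _ ij) (cp _ _ ij)).
move=> /seteqP[/(_ _ erefl) <- _].
move=> /seteqP[_ /(_ _ erefl)] [/pointsE ck /pointsE cl].
have sub m : side (c m) (contact (c i) (c j)) = 0 -> m \in [set i; j]%SET.
  move=> cm; apply: contraPT cm; rewrite !inE negb_or => /andP[mi mj] cm.
  by have := side4 _ _ _ ij mi mj; rewrite cm; lra.
apply/esym/eqP; rewrite eqEcard finset.subUset !finset.sub1set !sub//=.
by rewrite !cards2 ij kl.
Qed.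

(** * Gram matrices and the inversion of W K W^T = 2 Q2 *)

(* K for the coordinate order (a, b, u), and 2 K^-1 below. *)
Definition inversive_form : 'M[R]_(1 + 3) :=
  let k := \row_j [:: - 2^-1; 0; 0]`_j in
  block_mx 0 k k^T (diag_mx (\row_j [:: 0; 1; 1]`_j)).

Definition dual_form : 'M[R]_(1 + 3) :=
  let d := \row_j [:: - 4; 0; 0]`_j in block_mx 0 d d^T diag022.

Lemma inversive_formK : inversive_form *m dual_form = 2%:M.
Proof.
rewrite /inversive_form /dual_form mulmx_block.
rewrite (scalar_mx_block 1 3 2) !mul0mx !mulmx0 !add0r.
congr block_mx; apply/matrixP => i j; rewrite !mxE !big_ord_recl !big_ord0 !mxE.
- by rewrite !ord1 /= ?mulr1n; field.
- by case: j => [[|[|[|]]]] //= ?; rewrite ?mxE /= ?mulr0n; ring.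
- by case: i => [[|[|[|]]]] //= ?; rewrite ?mxE /= ?mulr0n; ring.
by case: i => [[|[|[|]]]] //= ?; case: j => [[|[|[|]]]] //= ?;
  rewrite ?mxE /= ?mulr0n ?mulr1n; field.
Qed.

Lemma ones4_sqr : (ones4 R)^T *m ones4 R = 4%:M.
Proof.
apply/matrixP => i j; rewrite !mxE !ord1 !big_ord_recl big_ord0 !mxE /= mulr1n.
by ring.
Qed.

(** [Q2] is the reflection in the hyperplane orthogonal to the vector of ones. *)
Lemma Q2K : Q2 *m Q2 = 1%:M :> 'M[R]_4.
Proof.
rewrite /Q2; set J := ones4 R *m _.
have JJ : J *m J = 4 *: J.
  rewrite /J mulmxA -[_ *m _ *m ones4 R]mulmxA ones4_sqr.
  by rewrite mul_mx_scalar scalemxAl.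
rewrite mulmxBl !mulmxBr !mul1mx mulmx1 -!scalemxAl -!scalemxAr JJ !scalerA.
have -> : 2^-1 * 2^-1 * 4 = 2^-1 + 2^-1 :> R by field.
by rewrite scalerDl opprB addrK subrK.
Qed.

Lemma double_Q2E i j : (2 *: Q2 : 'M[R]_4) i j = 2 * (i == j)%:R - 1.
Proof. by rewrite !mxE big_ord_recl big_ord0 !mxE; field. Qed.

Lemma Q2T : Q2^T = Q2 :> 'M[R]_4.
Proof. by rewrite /Q2 linearB /= linearZ /= trmx1 trmx_mul trmxK. Qed.

Lemma mulmx_scalarC n (x : R) (A B : 'M[R]_n) : x != 0 ->
  A *m B = x%:M -> B *m A = x%:M.
Proof.
move=> x0 AB; have: (x^-1 *: A) *m B = 1%:M.
  by rewrite -scalemxAl AB scale_scalar_mx mulVf.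
move/mulmx1C; rewrite -scalemxAr => /(congr1 ( *:%R x)).
by rewrite scalerA mulfV// scale1r scale_scalar_mx mulr1.
Qed.

(** With K = [inversive_form], the two sides say that K W^T Q2 / 2 is a right, respectively left,
    inverse of the square matrix W. *)
Lemma gramP (W : 'M[R]_(4, 1 + 3)) :
  W *m inversive_form *m W^T = 2 *: Q2 <-> W^T *m Q2 *m W = dual_form.
Proof.
have n2 : 2 != 0 :> R by rewrite pnatr_eq0.
split=> h.
  have : W *m (inversive_form *m W^T *m Q2) = 2%:M.
    by rewrite !mulmxA h -scalemxAl Q2K scale_scalar_mx mulr1.
  move=> /(mulmx_scalarC n2) /(congr1 (mulmx dual_form)).
  rewrite -!mulmxA (mulmxA dual_form) (mulmx_scalarC n2 inversive_formK).
  rewrite mul_scalar_mx mul_mx_scalar => /(scalerI n2).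
  by rewrite mulmxA.
have : inversive_form *m W^T *m Q2 *m W = 2%:M.
  by rewrite -!mulmxA (mulmxA W^T) h inversive_formK.
move=> /(mulmx_scalarC n2) /(congr1 (mulmx^~ Q2)).
by rewrite -!mulmxA Q2K mulmx1 mul_scalar_mx.
Qed.

Definition cocurvature_col c : 'cV[R]_4 := \col_i cocurvature (c i).

Definition augmented_mx c := row_mx (cocurvature_col c) (curvature_center_mx c).

Lemma curvature_center_mxE c i :
  ((curvature_center_mx c i 0 = curvature (c i)) *
   (curvature_center_mx c i 1 = (moment (c i)).1) *
   (curvature_center_mx c i 2 = (moment (c i)).2))%type.
Proof. by rewrite !mxE; case: (c i) => *; rewrite !mxE. Qed.

Lemma mulmx_inversive_form (a : 'cV[R]_4) (M : 'M[R]_(4, 3)) i j :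
  (row_mx a M *m inversive_form *m (row_mx a M)^T) i j =
  M i 1 * M j 1 + M i 2 * M j 2 - (a i 0 * M j 0 + M i 0 * a j 0) / 2.
Proof.
rewrite /inversive_form tr_row_mx mul_row_block mulmx0 add0r mul_row_col.
rewrite mul_mx_diag.
rewrite !mxE !big_ord_recl !big_ord0 !mxE !big_ord_recl !big_ord0 !mxE /=.
have -> : lift ord0 ord0 = 1 :> 'I_3 by exact/val_inj.
have -> : lift ord0 (lift ord0 ord0) = 2 :> 'I_3 by exact/val_inj.
rewrite !ord1 -[ord0]/(0 : 'I_3).
by field.
Qed.

Lemma gram_pairing c i j :
  (augmented_mx c *m inversive_form *m (augmented_mx c)^T) i j =
  pairing (c i) (c j).
Proof.
by rewrite mulmx_inversive_form !curvature_center_mxE !mxE.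
Qed.

(** * Completing M by a column, and the two implications *)

(** The column is sought as a = x Q2 b + M g, with b the first column of M. Then M^T Q2 a = x p +
    diag(0, 2, 2) g, where p = M^T b. *)
Lemma complete_basis (M : 'M[R]_(4, 3)) : M^T *m Q2 *m M = diag022 ->
  (exists i, M i 0 != 0) ->
  exists a, (row_mx a M)^T *m Q2 *m row_mx a M = dual_form.
Proof.
move=> MQM [i0 Mi0]; pose b := col 0 M; pose p : 'cV_3 := M^T *m b.
have p0 : 0 < p 0 0.
  rewrite !mxE (bigD1 i0)//= !mxE ltr_pwDl//.
    by rewrite -expr2 exprn_even_gt0.
  by apply: sumr_ge0 => i _; rewrite !mxE -expr2 sqr_ge0.
have {}p0 : p 0 0 != 0 by rewrite gt_eqF.
(* The first entry x p_0 must be -4; here p_0 = |b|^2. *)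
pose x := - 4 / p 0 0.
have xp : x * p 0 0 = - 4 by rewrite divfK.
clearbody x.
(* Entries 1 and 2 make the other entries of M^T Q2 a vanish; entry 0 then solves a^T Q2 a = 0. *)
pose g : 'cV[R]_3 := \col_j [:: - (x ^+ 2) / 16 * (p 1 0 ^+ 2 + p 2 0 ^+ 2);
  - (x * p 1 0) / 2; - (x * p 2 0) / 2]`_j.
pose a := x *: (Q2 *m b) + M *m g.
pose d : 'rV[R]_3 := \row_j [:: - 4; 0; 0]`_j.
have bQb : b^T *m Q2 *m b = 0.
  rewrite /b colE trmx_mul trmx_delta !mulmxA.
  rewrite -(mulmxA _ M^T) -(mulmxA _ _ M) MQM.
  by rewrite -rowE -colE; apply/matrixP => i j; rewrite !ord1 !mxE.
have ord3E (i : 'I_3) : [\/ i = 0, i = 1 | i = 2].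
  by case: i => [[|[|[|]]]] //= ?;
    [constructor 1|constructor 2|constructor 3]; apply/val_inj.
have MQa : M^T *m Q2 *m a = d^T.
  rewrite mulmxDr -scalemxAr -!mulmxA (mulmxA Q2 Q2) Q2K mul1mx !mulmxA MQM.
  rewrite -/p /g /diag022 mul_diag_mx; apply/matrixP => i j.
  rewrite ord1 mxE [X in X + _]mxE.
  move: (p) xp => q xq.
  by case: (ord3E i) => ->; rewrite !mxE /= ?xq; field.
have aQM : a^T *m Q2 *m M = d.
  by apply: trmx_inj; rewrite !trmx_mul trmxK Q2T mulmxA.
have ab : a^T *m b = g^T *m p.
  rewrite linearD linearZ /= !trmx_mul Q2T mulmxDl -scalemxAl bQb scaler0 add0r.
  by rewrite -mulmxA.
exists a; rewrite tr_row_mx mul_col_mx mul_col_row MQa aQM MQM.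
congr block_mx.
rewrite {2}/a mulmxDr -scalemxAr !mulmxA aQM -(mulmxA _ Q2 Q2) Q2K mulmx1 ab.
apply/matrixP => i j; rewrite !ord1 mxE [X in X + _]mxE.
rewrite ![(_ *m _) 0 0]mxE !big_ord_recl !big_ord0.
have -> : lift ord0 ord0 = 1 :> 'I_3 by exact/val_inj.
have -> : lift ord0 (lift ord0 ord0) = 2 :> 'I_3 by exact/val_inj.
rewrite -[ord0]/(0 : 'I_3).
rewrite /d /g; move: (p) xp => q xq; rewrite !mxE /=.
transitivity ((x * q 0 0 + 4) * - (x ^+ 2 / 16 * (q 1 0 ^+ 2 + q 2 0 ^+ 2))).
  by field.
by rewrite xq addNr mul0r.
Qed.

Lemma pairing_gram c :
  (forall i j, i != j -> pairing (c i) (c j) = -1) ->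
  augmented_mx c *m inversive_form *m (augmented_mx c)^T = 2 *: Q2.
Proof.
move=> cp; apply/matrixP => i j; rewrite gram_pairing double_Q2E.
have [<-|ij] := eqVneq i j; first by rewrite pairingCC /=; ring.
by rewrite cp//=; ring.
Qed.

Lemma oriented_descartes_gram c : oriented_descartes c ->
  (curvature_center_mx c)^T *m Q2 *m curvature_center_mx c = diag022.
Proof.
move=> /oriented_descartes_pairing /pairing_gram /gramP.
by rewrite tr_row_mx mul_col_mx mul_col_row => /eq_block_mx[].
Qed.

Lemma gram_oriented_descartes c : (forall i, curvature (c i) != 0) ->
  (curvature_center_mx c)^T *m Q2 *m curvature_center_mx c = diag022 ->
  oriented_descartes c.
Proof.
move=> c0 cM; apply: pairing_oriented_descartes => // i j ij.
have [|a /gramP aM] := complete_basis cM.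
  by exists 0; rewrite curvature_center_mxE.
(* Both columns satisfy |u|^2 - a b = 1, which determines a since b is nonzero. *)
have aE k : a k 0 = cocurvature (c k).
  have := pairingCC (c k); have := congr1 (fun A : 'M_4 => A k k) aM.
  rewrite double_Q2E mulmx_inversive_form !curvature_center_mxE.
  rewrite /pairing /dot eqxx /=.
  by move=> h1 h2; apply: (mulfI (c0 k)); lra.
have {}aE : a = cocurvature_col c.
  by apply/matrixP => k l; rewrite ord1 aE mxE.
by rewrite -gram_pairing /augmented_mx -aE aM double_Q2E (negbTE ij) /=; ring.
Qed.

End InversiveCoordinates.

Theorem theorem2p2 (R : realType) :
  (forall c : 'I_4 -> ocircle R,
     (forall i, curvature (c i) != 0) ->
     (oriented_descartes c <->
      (curvature_center_mx c)^T *m Q2 *m curvature_center_mx c = diag022))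
  /\
  (forall c : 'I_4 -> ocircle R,
     oriented_descartes c ->
     (#|[set i | curvature (c i) == 0]%SET| = 1%N \/
      #|[set i | curvature (c i) == 0]%SET| = 2%N) ->
     (curvature_center_mx c)^T *m Q2 *m curvature_center_mx c = diag022).
Proof.
split=> [c c0|c cD _]; last exact: oriented_descartes_gram.
by split; [exact: oriented_descartes_gram | exact: gram_oriented_descartes].
Qed.
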